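(* Let $d\ge 2$, let $0<\epsilon\le 1/2$, and let $\sigma\in\mathbb{C}^{d\times d}$ be a quantum state all of whose eigenvalues are at least $2\epsilon/d$. Then there is an absolute constant $c>0$ such that any algorithm that $\epsilon$-certifies $\sigma$ must use at least \[ c\cdot\frac{d^{5/2}}{\|\sigma^{-1}\|_2\,\epsilon^2} \] copies of the unknown state. In particular, for any constant $a>0$, if all eigenvalues of $\sigma$ are at least $a/d$, then the number of copies is $\Omega(d/\epsilon^2)$ (with the hidden constant depending only on $a$).
   Context: $\|\cdot\|_2$ is the Hilbert–Schmidt (Schatten-2) norm. Task ($\epsilon$-certification of $\sigma$): a density matrix $\sigma\in\mathbb{C}^{d\times d}$ is given by explicit description; the algorithm receives $n$ copies of an unknown density matrix $\rho$, promised that either $\rho=\sigma$ or $\|\rho-\sigma\|_1\ge\epsilon$ (trace norm), and must decide which holds with probability at least $2/3$, using arbitrary measurements, possibly entangled across all copies. *)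

(* Defs.v *)
(* matrices over an algebraically closed numeric field C,
   instantiated with C := R[i] for R : realType (the complex numbers). *)
From HB Require Import structures.
From mathcomp Require Import all_boot all_order all_algebra.
From mathcomp Require Import reals.
From mathcomp.real_closed Require Import complex mxtens.

Set Implicit Arguments.
Unset Strict Implicit.
Unset Printing Implicit Defensive.

Import Order.TTheory GRing.Theory Num.Theory.
Local Open Scope ring_scope.

Section QuantumDefs.
Variable C : numClosedFieldType.

Definition adjmx m n (A : 'M[C]_(m, n)) : 'M[C]_(n, m) := (map_mx Num.conj A)^T.

Definition psdmx n (A : 'M[C]_n) : Prop :=
  A = adjmx A /\ forall v : 'cV[C]_n, 0 <= (adjmx v *m A *m v) 0 0.

Definition density_matrix n (rho : 'M[C]_n) : Prop :=
  psdmx rho /\ \tr rho = 1.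

(* the eigenvalues of A listed with algebraic multiplicity
   (roots of the characteristic polynomial) *)
Definition eigvals n (A : 'M[C]_n) : seq C :=
  sval (closed_field_poly_normal (char_poly A)).

Definition trnorm n (A : 'M[C]_n) : C :=
  \sum_(l <- eigvals (adjmx A *m A)) sqrtC l.

Definition hsnorm m n (A : 'M[C]_(m, n)) : C :=
  sqrtC (\sum_i \sum_j `|A i j| ^+ 2).

Definition tpow d (A : 'M[C]_d) (n : nat) : 'M[C]_(d ^ n) := ntensmx A n.

(* A (most general) certification algorithm using n copies of a d-dimensional
   state: a two-outcome POVM {M, 1 - M} on (C^d)^{(x) n}; outcome M means
   "accept: rho = sigma". It eps-certifies sigma if it accepts sigma^{(x)n}
   with probability >= 2/3 and rejects every state rho with
   ||rho - sigma||_1 >= eps with probability >= 2/3. *)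
Definition certifies d (sigma : 'M[C]_d) (eps : C) (n : nat)
    (M : 'M[C]_(d ^ n)) : Prop :=
  psdmx M /\ psdmx (1%:M - M) /\
  2 / 3 <= \tr (M *m tpow sigma n) /\
  forall rho : 'M[C]_d, density_matrix rho -> eps <= trnorm (rho - sigma) ->
    1 - \tr (M *m tpow rho n) >= 2 / 3.

End QuantumDefs.

(* Main.v *)
Require Import Defs.
From HB Require Import structures.
From mathcomp Require Import all_boot all_order all_algebra.
From mathcomp Require Import ring zify.
From mathcomp Require Import reals.
From mathcomp.real_closed Require Import complex mxtens.
Import Order.TTheory GRing.Theory Num.Theory.
Local Open Scope ring_scope.

Set Implicit Arguments.
Unset Strict Implicit.
Unset Printing Implicit Defensive.

(** Le Cam's method with a chi-square bound. Let 2^r = m with 2m <= d <= 4m and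
let h be the normalized Hadamard matrix of size m. In an eigenbasis of sigma,
perturb sigma by eta = eps/(2m) times the block matrix [[0, W], [W^T, 0]], where
W i j = x i * h i j * y j is orthogonal and x, y are vectors of signs. All these
states are eps-far from sigma. A test separating sigma^n from the uniform
mixture of the n-th tensor powers of the perturbed states forces the average of
tr(sigma^-1 rho_w rho_w')^n - 1 to be at least 1/9. Since h is flat, this trace is
1 + (eta^2/m) Z, with Z = (a.z)(1.w) + (1.z)(b.w) for uniform signs z, w and
a, b subvectors of the inverse spectrum of sigma. Khinchine's inequality bounds
the even moments of Z, and summing the binomial series shows that the average
is smaller than 1/9 unless n is large. *)

(** * Moments of sign sums *)

Lemma sum_double (V : zmodType) (F : nat -> V) N :
  \sum_(i < N.*2) F i = \sum_(j < N) (F j.*2 + F j.*2.+1).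
Proof.
elim: N => [|N IH]; first by rewrite !big_ord0.
by rewrite doubleS !big_ord_recr /= IH addrA.
Qed.

(** The odd powers of [y] cancel. Any [N] with [n < 2N] serves, since the binomial coefficients
    beyond [n] vanish. *)
Lemma exprD_addB (R : comNzRingType) (x y : R) n N : (n < N.*2)%N ->
  (x + y) ^+ n + (x - y) ^+ n =
  2 * \sum_(j < N) x ^+ (n - j.*2) * y ^+ j.*2 *+ 'C(n, j.*2).
Proof.
move=> nN.
have E (t : R) : (x + t) ^+ n =
    \sum_(i < N.*2) x ^+ (n - i) * t ^+ i *+ 'C(n, i).
  rewrite exprDn (big_ord_widen _ (fun i => x ^+ (n - i) * t ^+ i *+ 'C(n, i)) nN).
  rewrite big_mkcond; apply: eq_bigr => i _; case: ifP => //.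
  by rewrite ltnS leqNgt => /negbFE ni; rewrite bin_small // mulr0n.
rewrite !E !(sum_double (fun i => x ^+ (n - i) * _ ^+ i *+ 'C(n, i))).
rewrite -big_split mulr_sumr; apply: eq_bigr => j _ /=.
rewrite !exprS -mul2n !exprM sqrrN !mulNr !mulrN mulNrn.
ring.
Qed.

Lemma double_fact_ge k : (2 ^ k * k`! <= (k.*2)`!)%N.
Proof.
elim: k => // k IH; rewrite doubleS !factS expnS.
have -> : (2 * 2 ^ k * (k.+1 * k`!) = k.*2.+2 * (2 ^ k * k`!))%N by lia.
by rewrite leq_mul2l /=; apply: leq_trans IH _; rewrite leq_pmull.
Qed.

Lemma natr_bin_fact (R : numFieldType) k j : (j <= k)%N ->
  'C(k, j)%:R / k`!%:R = j`!%:R^-1 * (k - j)`!%:R^-1 :> R.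
Proof.
move=> jk; have nz p : p`!%:R != 0 :> R by rewrite pnatr_eq0 -lt0n fact_gt0.
rewrite -(bin_fact jk) !natrM; field.
by rewrite !nz pnatr_eq0 -lt0n bin_gt0.
Qed.

Section Rademacher.
Variables (R : numFieldType) (I : finType).
Implicit Types (z : {ffun I -> bool}) (a b : I -> R) (r : seq I).

Definition rsign z i : R := (-1) ^+ z i.

Definition flip1 (i : I) z : {ffun I -> bool} :=
  [ffun j => (j == i) (+) z j].

Lemma flip1K i : involutive (flip1 i).
Proof. by move=> z; apply/ffunP => j; rewrite !ffunE addbA addbb. Qed.

Lemma rsign_flip1 i z j :
  rsign (flip1 i z) j = if j == i then - rsign z j else rsign z j.
Proof.
by rewrite /rsign ffunE; case: eqP => _; rewrite //= signrN.
Qed.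

Lemma rsign_real z i : rsign z i \is Num.real.
Proof. by rewrite /rsign; case: (z i); rewrite ?expr1 ?expr0 ?realN real1. Qed.

(** This is the coefficientwise form of [cosh t <= exp (t^2 / 2)]. Dividing by [(2k)!] turns the
    binomial expansion into a convolution, so that an induction on [r] can compare the two sides
    term by term. The sums range over the full sign cube, which lets one coordinate be flipped at
    each step. *)
Lemma khinchine_seq a r k : (forall i, a i \is Num.real) -> uniq r ->
  \sum_z (\sum_(i <- r) a i * rsign z i) ^+ k.*2 / (k.*2)`!%:R <=
  #|{ffun I -> bool}|%:R * (\sum_(i <- r) a i ^+ 2) ^+ k / (2 ^ k * k`!)%:R.
Proof.
move=> ar; elim: r k => [|i r IH] k /=.
  move=> _; under eq_bigr do rewrite big_nil; rewrite big_nil.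
  rewrite sumr_const; case: k => [|k]; last first.
    by rewrite !expr0n /= ?(mul0r, mulr0) mul0rn.
  by rewrite !expr0 mulr1 !fact0 expn0 muln1 invr1 !mulr1 ler_nat max_card.
case/andP => ir ur.
set S := fun z => \sum_(i <- r) a i * rsign z i.
set V := \sum_(i <- r) a i ^+ 2.
set K := #|_|%:R.
have Sflip z : S (flip1 i z) = S z.
  apply: eq_big_seq => j jr; rewrite rsign_flip1; case: eqP => // ji.
  by rewrite -ji jr in ir.
have a2 j : 0 <= a j ^+ 2 by rewrite -realEsqr.
have -> : \sum_z (\sum_(j <- i :: r) a j * rsign z j) ^+ k.*2 / (k.*2)`!%:R
   = \sum_(j < k.+1) a i ^+ j.*2 / (j.*2)`!%:R *
       \sum_z S z ^+ (k - j).*2 / ((k - j).*2)`!%:R.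
  set T := LHS.
  (* Flipping the sign at [i] fixes [S] because [i] is not in [r]; averaging over this flip kills
     the odd powers of [a i]. *)
  have TE : T + T = \sum_z ((S z + a i) ^+ k.*2 + (S z - a i) ^+ k.*2) / (k.*2)`!%:R.
    rewrite {2}/T (reindex_inj (inv_inj (flip1K i))) -big_split.
    apply: eq_bigr => z _ /=.
    rewrite !big_cons -/(S z) -/(S (flip1 i z)) Sflip rsign_flip1 eqxx.
    rewrite /rsign; case: (z i) => /=; rewrite ?expr1 ?expr0 -mulrDl.
      by rewrite opprK mulrN1 mulr1 addrC; congr (_ / _); congr (_ ^+ _ + _ ^+ _); ring.
    by rewrite mulrN1 mulr1; congr (_ / _); congr (_ ^+ _ + _ ^+ _); ring.
  apply: (@mulfI _ 2); first by rewrite pnatr_eq0.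
  rewrite [LHS]mulr_natl mulr2n TE.
  under eq_bigr => z _.
    rewrite (@exprD_addB _ _ _ _ k.+1); last by rewrite doubleS.
    rewrite -mulrA mulr_suml; over.
  rewrite -mulr_sumr exchange_big /=; congr (_ * _); apply: eq_bigr => j _.
  rewrite mulr_sumr; apply: eq_bigr => z _.
  have jk : (j <= k)%N by rewrite -ltnS.
  rewrite -mulr_natr -[LHS]mulrA natr_bin_fact ?leq_double // -doubleB.
  ring.
have -> : K * (\sum_(j <- i :: r) a j ^+ 2) ^+ k / (2 ^ k * k`!)%:R
   = \sum_(j < k.+1) a i ^+ j.*2 / (2 ^ j * j`!)%:R *
       (K * V ^+ (k - j) / (2 ^ (k - j) * (k - j)`!)%:R).
  rewrite big_cons -/V addrC exprDn mulr_sumr mulr_suml.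
  apply: eq_bigr => j _.
  have jk : (j <= k)%N by rewrite -ltnS.
  have -> : (2 ^ k = 2 ^ j * 2 ^ (k - j))%N by rewrite -expnD subnKC.
  rewrite -mul2n exprM -mulr_natr !natrM !invfM.
  transitivity (a i ^+ 2 ^+ j * (2 ^ j)%:R^-1 * K * V ^+ (k - j) * (2 ^ (k - j))%:R^-1 *
     ('C(k, j)%:R / k`!%:R)); last by rewrite natr_bin_fact //; ring.
  ring.
apply: ler_sum => j _.
apply: le_trans (_ : a i ^+ j.*2 / (j.*2)`!%:R *
       (K * V ^+ (k - j) / (2 ^ (k - j) * (k - j)`!)%:R) <= _).
  apply: ler_wpM2l (IH _ ur).
  by rewrite divr_ge0 ?ler0n // -muln2 mulnC exprM exprn_ge0.
apply: ler_wpM2r.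
  by rewrite divr_ge0 ?ler0n // mulr_ge0 ?ler0n // exprn_ge0 // sumr_ge0.
apply: ler_wpM2l.
  by rewrite -muln2 mulnC exprM exprn_ge0.
(* The only loss in the induction step is [2^j j! <= (2j)!] in the coefficient of [a i ^ (2j)]. *)
rewrite lef_pV2 ?ler_nat ?double_fact_ge // posrE ltr0n ?fact_gt0 //.
by rewrite muln_gt0 expn_gt0 fact_gt0.
Qed.



Lemma khinchine a k : (forall i, a i \is Num.real) ->
  \sum_z (\sum_i a i * rsign z i) ^+ k.*2 <=
  #|{ffun I -> bool}|%:R * (\sum_i a i ^+ 2) ^+ k * ((k.*2)`!%:R / (2 ^ k * k`!)%:R).
Proof.
move=> ar; have := khinchine_seq k ar (index_enum_uniq I).
rewrite -mulr_suml ler_pdivrMr ?ltr0n ?fact_gt0 // => /le_trans; apply.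
by rewrite le_eqVlt; apply/orP; left; apply/eqP; ring.
Qed.

Lemma real_signsum a z : (forall i, a i \is Num.real) ->
  \sum_i a i * rsign z i \is Num.real.
Proof. by move=> ar; apply: sum_real => i _; rewrite realM ?rsign_real. Qed.

Definition flip z : {ffun I -> bool} := [ffun i => ~~ z i].

Lemma flipK : involutive flip.
Proof. by move=> z; apply/ffunP => i; rewrite !ffunE negbK. Qed.

Lemma rsign_flip z i : rsign (flip z) i = - rsign z i.
Proof. by rewrite /rsign ffunE; case: (z i); rewrite //= ?expr1 ?expr0 ?opprK. Qed.

End Rademacher.

(** [(2k)!] is at most the square of its even part [2^k k!]. Hence the product of two Khinchine
    constants is at most [(2k)!]. *)
Lemma sqr_central_fact_le k : (((k.*2)`!) ^ 2 <= (k.*2)`! * (2 ^ k * k`!) ^ 2)%N.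
Proof.
rewrite -mulnn leq_pmul2l ?fact_gt0 //.
elim: k => // k IH; rewrite doubleS !factS (expnS 2 k).
have -> : ((2 * 2 ^ k * (k.+1 * k`!)) ^ 2 = (k.*2.+2 * k.*2.+2) * (2 ^ k * k`!) ^ 2)%N.
  by rewrite -muln2; lia.
by rewrite mulnA leq_mul // leq_mul2l ltnW ?orbT.
Qed.

Lemma exprD_le2n (R : numFieldType) (x y : R) k : 0 <= x -> 0 <= y ->
  (x + y) ^+ k <= 2 ^+ k * (x ^+ k + y ^+ k).
Proof.
move=> x0 y0; wlog xy : x y x0 y0 / x <= y.
  move=> H; have /orP[|] := real_leVge (ger0_real x0) (ger0_real y0).
    by apply: H.
  by rewrite addrC [x ^+ k + _]addrC; apply: H.
apply: le_trans (_ : (2 * y) ^+ k <= _).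
  by rewrite lerXn2r ?nnegrE ?addr_ge0 ?mulr_ge0 ?ler0n // mulr_natl mulr2n lerD2r.
by rewrite exprMn ler_wpM2l ?exprn_ge0 ?ler0n // lerDr exprn_ge0.
Qed.

Lemma ffact_le_expn n k : (n ^_ k <= n ^ k)%N.
Proof. by elim: k => // k IH; rewrite ffactnSr expnSr leq_mul // leq_subr. Qed.

(** * Moments of a bilinear form in independent signs *)

Section BilinearChaos.
Variables (R : numFieldType) (I J : finType).
Local Notation cube T := {ffun T -> bool}.
Local Notation K := (#|cube I|%:R * #|cube J|%:R : R).

(** The double sum factors because [z] and [w] are independent, and Khinchine's inequality applies
    to each factor. *)
Lemma chaos1_moment (a : I -> R) (b : J -> R) k :
  (forall i, a i \is Num.real) -> (forall j, b j \is Num.real) ->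
  \sum_(z : cube I) \sum_(w : cube J)
     ((\sum_i a i * rsign R z i) * (\sum_j b j * rsign R w j)) ^+ k.*2 <=
  K * ((\sum_i a i ^+ 2) * (\sum_j b j ^+ 2)) ^+ k * (k.*2)`!%:R.
Proof.
move=> ar br.
have even_ge0 (x : R) : x \is Num.real -> 0 <= x ^+ k.*2.
  by move=> xr; rewrite -muln2 mulnC exprM exprn_ge0 // -realEsqr.
have -> : \sum_(z : cube I) \sum_(w : cube J)
     ((\sum_i a i * rsign R z i) * (\sum_j b j * rsign R w j)) ^+ k.*2 =
  (\sum_z (\sum_i a i * rsign R z i) ^+ k.*2) *
  (\sum_w (\sum_j b j * rsign R w j) ^+ k.*2).
  rewrite mulr_suml; apply: eq_bigr => z _; rewrite mulr_sumr.
  by apply: eq_bigr => w _; rewrite exprMn.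
have := khinchine k ar; have := khinchine k br.
set A := \sum_i a i ^+ 2; set B := \sum_j b j ^+ 2 => hb ha.
have A0 : 0 <= A by apply: sumr_ge0 => i _; rewrite -realEsqr.
have B0 : 0 <= B by apply: sumr_ge0 => i _; rewrite -realEsqr.
apply: le_trans (ler_pM _ _ ha hb) _.
- by apply: sumr_ge0 => z _; rewrite even_ge0 // real_signsum.
- by apply: sumr_ge0 => z _; rewrite even_ge0 // real_signsum.
set f := (_ / _).
have -> : #|cube I|%:R * A ^+ k * f * (#|cube J|%:R * B ^+ k * f) =
   K * (A * B) ^+ k * f ^+ 2 by rewrite exprMn; ring.
apply: ler_wpM2l; first by rewrite !mulr_ge0 ?exprn_ge0 ?mulr_ge0 ?ler0n.
rewrite expr_div_n ler_pdivrMr; last first.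
  by rewrite exprn_gt0 // ltr0n muln_gt0 expn_gt0 fact_gt0.
by rewrite -!natrX -natrM ler_nat sqr_central_fact_le.
Qed.

(** This is the bilinear form with coefficients [a i + b j], grouped as a sum of two products. *)
Definition chaos (a : I -> R) (b : J -> R) (z : cube I) (w : cube J) :=
  (\sum_i a i * rsign R z i) * (\sum_j rsign R w j) +
  (\sum_i rsign R z i) * (\sum_j b j * rsign R w j).

Lemma chaos_flip a b z w : chaos a b (flip z) w = - chaos a b z w.
Proof.
rewrite /chaos opprD -!mulNr -!sumrN; congr (_ * _ + _ * _).
  by apply: eq_bigr => i _; rewrite rsign_flip mulrN.
by apply: eq_bigr => i _; rewrite rsign_flip.
Qed.

Variables (a : I -> R) (b : J -> R).
Hypotheses (ar : forall i, a i \is Num.real) (br : forall j, b j \is Num.real).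
Variable V : R.
Hypotheses (aV : (\sum_i a i ^+ 2) * #|J|%:R <= V).
Hypotheses (bV : #|I|%:R * (\sum_j b j ^+ 2) <= V).

(** With [p], [q] the two products, [(p + q)^2 <= 2 (p^2 + q^2)], and [exprD_le2n] then gives
    [(p + q)^(2k) <= 4^k (p^(2k) + q^(2k))]; each product is covered by [chaos1_moment]. *)
Lemma chaos_moment k :
  \sum_z \sum_w chaos a b z w ^+ k.*2 <= 2 * K * (4 * V) ^+ k * (k.*2)`!%:R.
Proof.
have one (T : finType) (z : cube T) :
    \sum_i rsign R z i = \sum_i 1 * rsign R z i.
  by apply: eq_bigr => i _; rewrite mul1r.
have oneV (T : finType) : \sum_(i : T) (1 : R) ^+ 2 = #|T|%:R.
  by rewrite -sumr_const; apply: eq_bigr => i _; rewrite expr1n.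
have r1 (T : finType) (i : T) : (1 : R) \is Num.real by rewrite real1.
have V0 : 0 <= V.
  apply: le_trans aV; rewrite mulr_ge0 ?ler0n // sumr_ge0 // => i _.
  by rewrite -realEsqr.
have H1 := chaos1_moment k ar (r1 J); have H2 := chaos1_moment k (r1 I) br.
rewrite !oneV in H1 H2.
set P := (X in X <= _) in H1; set Q := (X in X <= _) in H2.
apply: le_trans (_ : 4 ^+ k * (P + Q) <= _).
  rewrite /P /Q -big_split mulr_sumr; apply: ler_sum => z _.
  rewrite -big_split mulr_sumr; apply: ler_sum => w _ /=.
  rewrite /chaos !(one _ _) -!muln2 !(mulnC k) !exprM.
  set p := _ * _; set q := _ * _.
  have pr : p \is Num.real by rewrite realM // real_signsum.
  have qr : q \is Num.real by rewrite realM // real_signsum.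
  move: p q pr qr => p q pr qr.
  apply: le_trans (_ : (2 * (p ^+ 2 + q ^+ 2)) ^+ k <= _).
    rewrite lerXn2r ?nnegrE -?realEsqr ?realD // ?mulr_ge0 ?ler0n //.
      by rewrite addr_ge0 // -realEsqr.
    rewrite -subr_ge0.
    have -> : 2 * (p ^+ 2 + q ^+ 2) - (p + q) ^+ 2 = (p - q) ^+ 2 by ring.
    by rewrite -realEsqr realB.
  have -> : 4 = 2 * 2 :> R by ring.
  rewrite (exprMn _ 2 (_ + _)) (exprMn _ 2 2) -mulrA ler_wpM2l ?exprn_ge0 ?ler0n //.
  by rewrite exprD_le2n // -realEsqr.
apply: le_trans (_ : 4 ^+ k * (K * V ^+ k * (k.*2)`!%:R + K * V ^+ k * (k.*2)`!%:R) <= _).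
  apply: ler_wpM2l; first by rewrite exprn_ge0 ?ler0n.
  apply: lerD.
    apply: le_trans H1 _; rewrite ler_wpM2r ?ler0n // ler_wpM2l ?mulr_ge0 ?ler0n //.
    rewrite lerXn2r ?nnegrE // mulr_ge0 ?ler0n // sumr_ge0 // => i _.
    by rewrite -realEsqr.
  apply: le_trans H2 _; rewrite ler_wpM2r ?ler0n // ler_wpM2l ?mulr_ge0 ?ler0n //.
  rewrite lerXn2r ?nnegrE // mulr_ge0 ?ler0n // sumr_ge0 // => i _.
  by rewrite -realEsqr.
by rewrite exprMn le_eqVlt; apply/orP; left; apply/eqP; ring.
Qed.

(** In the binomial expansion, the factor [(2j)!] of the moment bound turns ['C(n, 2j)] into a
    falling factorial, at most [n^(2j)]. The term of order [2j] is thus at most [2 K q^j], and the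
    terms with [j > 0] form a geometric series. *)
Lemma chaos_chi2 n (mu q : R) : 0 <= mu -> q = 4 * V * n%:R ^+ 2 * mu ^+ 2 ->
  q <= 1 / 20 ->
  \sum_z \sum_w (1 + mu * chaos a b z w) ^+ n < (1 + 1 / 9) * K.
Proof.
move=> mu0 qE q20.
have V0 : 0 <= V.
  apply: le_trans aV; rewrite mulr_ge0 ?ler0n // sumr_ge0 // => i _.
  by rewrite -realEsqr.
have q0 : 0 <= q by rewrite qE !mulr_ge0 ?exprn_ge0 ?ler0n.
have K0 : 0 < K.
  by rewrite mulr_gt0 // ltr0n card_ffun card_bool expn_gt0.
set T := (X in X < _).
(* Negating all signs of [z] negates the form, so odd moments disappear. *)
have TE : T = \sum_(j < n.+1) mu ^+ j.*2 * 'C(n, j.*2)%:R *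
    \sum_z \sum_w chaos a b z w ^+ j.*2.
  apply: (@mulfI _ 2); first by rewrite pnatr_eq0.
  rewrite [LHS]mulr_natl mulr2n {2}/T (reindex_inj (inv_inj (@flipK I))).
  rewrite -big_split.
  under eq_bigr => z _.
    rewrite -big_split; under eq_bigr => w _.
      rewrite /= chaos_flip mulrN (@exprD_addB _ _ _ _ n.+1); last by lia.
      over.
    rewrite /= -mulr_sumr exchange_big; over.
  rewrite -mulr_sumr exchange_big /=; congr (_ * _); apply: eq_bigr => j _.
  rewrite mulr_sumr; apply: eq_bigr => z _.
  rewrite mulr_sumr; apply: eq_bigr => w _.
  by rewrite expr1n exprMn -mulr_natr; ring.
have term (j : nat) : mu ^+ j.*2 * 'C(n, j.*2)%:R *
    \sum_z \sum_w chaos a b z w ^+ j.*2 <= 2 * K * q ^+ j.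
  apply: le_trans (_ : mu ^+ j.*2 * 'C(n, j.*2)%:R *
     (2 * K * (4 * V) ^+ j * (j.*2)`!%:R) <= _).
    by rewrite ler_wpM2l ?chaos_moment // mulr_ge0 ?ler0n ?exprn_ge0.
  have -> : q ^+ j = (4 * V) ^+ j * (n%:R ^+ j.*2 * mu ^+ j.*2).
    by rewrite qE -!mul2n !exprM !exprMn; ring.
  have -> : mu ^+ j.*2 * 'C(n, j.*2)%:R * (2 * K * (4 * V) ^+ j * (j.*2)`!%:R) =
     2 * K * (4 * V) ^+ j * mu ^+ j.*2 * ('C(n, j.*2) * (j.*2)`!)%:R.
    by rewrite natrM; ring.
  rewrite [n%:R ^+ _ * _]mulrC !mulrA ler_wpM2l ?mulr_ge0 ?exprn_ge0 ?mulr_ge0 ?ler0n //.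
  by rewrite -natrX ler_nat bin_ffact ffact_le_expn.
have K1 : \sum_(z : cube I) \sum_(w : cube J) (1 : R) = K.
  under eq_bigr do rewrite sumr_const.
  by rewrite sumr_const -natrM -mulrnA mulnC.
rewrite TE big_ord_recl /= double0 expr0 bin0 !mul1r.
under eq_bigr do under eq_bigr do rewrite expr0.
rewrite K1 mulrDl mul1r ltrD2l.
have geo : (1 - q) * \sum_(i < n) q ^+ i <= 1.
  have /(congr1 -%R) := subrX1 q n; rewrite opprB -mulNr opprB => <-.
  by rewrite gerBl exprn_ge0.
have S0 : 0 <= \sum_(i < n) q ^+ i by apply: sumr_ge0 => i _; rewrite exprn_ge0.
apply: le_lt_trans (_ : 2 * K * (q * \sum_(i < n) q ^+ i) < _).
  rewrite !mulr_sumr; apply: ler_sum => i _.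
  by rewrite -exprS; apply: (term (lift ord0 i)).
rewrite -mulrA mulrCA [X in _ < X]mulrC ltr_pM2l //.
set S := \sum_(_ < _) _ in S0 geo *.
have qS : 20 * (q * S) <= S.
  by rewrite mulrA ler_piMl //; move: q20; rewrite ler_pdivlMr ?ltr0n // mulrC.
have S19 : 19 * S <= 20.
  have : (1 - 1 / 20) * S <= 1.
    by apply: le_trans geo; rewrite ler_wpM2r // lerD2l lerN2.
  have -> : 1 - 1 / 20 = 19 / 20 :> R by field.
  by rewrite mulrAC ler_pdivrMr ?ltr0n // mul1r.
rewrite -[_^-1]div1r ltr_pdivlMr ?ltr0n //.
(* Since [q S <= S / 20] and [S <= 20 / 19], the excess [2 q S] is at most [2 / 19 < 1 / 9]; the
   factor [19 * 20] clears denominators. *)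
suff : (19 * 20) * (2 * (q * S) * 9) < (19 * 20) * 1 by rewrite ltr_pM2l ?mulr_gt0 ?ltr0n.
apply: le_lt_trans (_ : 18 * (19 * S) < _).
  have -> : 19 * 20 * (2 * (q * S) * 9) = 18 * (19 * (20 * (q * S))) by ring.
  by rewrite !ler_wpM2l ?ler0n.
apply: le_lt_trans (_ : 18 * 20 < _); first by rewrite ler_wpM2l ?ler0n.
by rewrite -!natrM mulr1 ltr_nat.
Qed.
End BilinearChaos.

(** * The chi-square bound *)

Section TensorPower.
Variable R : comNzRingType.

Lemma mxtrace_tens m n (A : 'M[R]_m) (B : 'M[R]_n) :
  \tr (tensmx A B) = \tr A * \tr B.
Proof. by rewrite /mxtrace mulr_sum; apply: eq_bigr => i _; rewrite mxE. Qed.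

Lemma tens_mx11 m n : tensmx (1%:M : 'M[R]_m) (1%:M : 'M[R]_n) = 1%:M.
Proof.
apply/matrixP => i j; rewrite !mxE -natrM mulnb.
congr ((_ : bool)%:R); rewrite -(can_eq (@mxtens_unindexK m n) i j).
by case: (mxtens_unindex i) (mxtens_unindex j) => ? ? [? ?]; rewrite xpair_eqE.
Qed.

Lemma ntensmx_mul m n p (A : 'M[R]_(m, n)) (B : 'M[R]_(n, p)) k :
  ntensmx (A *m B) k = ntensmx A k *m ntensmx B k.
Proof.
case: k => [|k]; first by rewrite /ntensmx mulmx1.
by elim: k => //= k IH; rewrite !ntensmxSS IH tensmx_mul.
Qed.

Lemma ntensmx_1 n k : ntensmx (1%:M : 'M[R]_n) k = 1%:M.
Proof.
by case: k => // k; elim: k => //= k IH; rewrite ntensmxSS IH tens_mx11.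
Qed.

Lemma mxtrace_ntens n (A : 'M[R]_n) k : \tr (ntensmx A k) = \tr A ^+ k.
Proof.
case: k => [|k]; first by rewrite /ntensmx mxtrace1 expr0.
by elim: k => [|k IH]; rewrite ?expr1 // ntensmxSS mxtrace_tens IH -exprS.
Qed.

End TensorPower.

(** * Adjoints and positive semidefinite matrices *)

Section Adjoint.
Variable C : numClosedFieldType.

Lemma adjmxK m n (A : 'M[C]_(m, n)) : adjmx (adjmx A) = A.
Proof. by apply/matrixP => i j; rewrite !mxE conjCK. Qed.

Lemma adjmxM m n p (A : 'M[C]_(m, n)) (B : 'M[C]_(n, p)) :
  adjmx (A *m B) = adjmx B *m adjmx A.
Proof. by rewrite /adjmx map_mxM trmx_mul. Qed.

Lemma adjmxD m n (A B : 'M[C]_(m, n)) : adjmx (A + B) = adjmx A + adjmx B.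
Proof. by apply/matrixP => i j; rewrite !mxE rmorphD. Qed.

Lemma adjmxB m n (A B : 'M[C]_(m, n)) : adjmx (A - B) = adjmx A - adjmx B.
Proof. by apply/matrixP => i j; rewrite !mxE rmorphB. Qed.

Lemma adjmxZ m n a (A : 'M[C]_(m, n)) : adjmx (a *: A) = a^* *: adjmx A.
Proof. by apply/matrixP => i j; rewrite !mxE rmorphM. Qed.

Lemma adjmx_sum m n (I : finType) (F : I -> 'M[C]_(m, n)) :
  adjmx (\sum_i F i) = \sum_i adjmx (F i).
Proof.
apply: (big_morph _ (@adjmxD m n)) => //.
by apply/matrixP => i j; rewrite !mxE conjC0.
Qed.

Lemma adjmx_scalar n (a : C) : adjmx (a%:M : 'M[C]_n) = (a^*)%:M.
Proof. by rewrite /adjmx map_scalar_mx tr_scalar_mx. Qed.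

Lemma adjmx1 n : adjmx (1%:M : 'M[C]_n) = 1%:M.
Proof. by rewrite adjmx_scalar rmorph1. Qed.

Lemma adjmx_tpow n (A : 'M[C]_n) k : adjmx (tpow A k) = tpow (adjmx A) k.
Proof.
rewrite /tpow; case: k => [|k]; first exact: adjmx1.
elim: k => //= k IH; rewrite !ntensmxSS -IH.
by rewrite /adjmx map_mxT trmx_tens.
Qed.

Lemma tpow_mul n (A B : 'M[C]_n) k : tpow (A *m B) k = tpow A k *m tpow B k.
Proof. exact: ntensmx_mul. Qed.

Lemma mxtrace_tpow n (A : 'M[C]_n) k : \tr (tpow A k) = \tr A ^+ k.
Proof. exact: mxtrace_ntens. Qed.

Lemma mxtrace_mul_adj m n (A : 'M[C]_(m, n)) :
  \tr (A *m adjmx A) = \sum_i \sum_j `|A i j| ^+ 2.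
Proof.
apply: eq_bigr => i _; rewrite mxE; apply: eq_bigr => j _.
by rewrite !mxE normCK.
Qed.

Lemma psdmx_gram m n (A : 'M[C]_(m, n)) : psdmx (adjmx A *m A).
Proof.
split=> [|v]; first by rewrite adjmxM adjmxK.
rewrite mulmxA -mulmxA -adjmxM mxE; apply: sumr_ge0 => i _.
by rewrite !mxE mulrC -normCK exprn_ge0.
Qed.

Lemma psdmxD n (A B : 'M[C]_n) : psdmx A -> psdmx B -> psdmx (A + B).
Proof.
move=> [Ah A0] [Bh B0]; split=> [|v]; first by rewrite adjmxD -Ah -Bh.
by rewrite mulmxDr mulmxDl mxE addr_ge0.
Qed.

Lemma psdmxZ n a (A : 'M[C]_n) : 0 <= a -> psdmx A -> psdmx (a *: A).
Proof.
move=> a0 [Ah A0]; split=> [|v].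
  by rewrite adjmxZ -Ah (CrealP (ger0_real a0)).
by rewrite -scalemxAr -scalemxAl mxE mulr_ge0.
Qed.

Lemma psdmx_conj m n (A : 'M[C]_m) (B : 'M[C]_(m, n)) :
  psdmx A -> psdmx (adjmx B *m A *m B).
Proof.
move=> [Ah A0]; split=> [|v]; first by rewrite !adjmxM adjmxK -Ah mulmxA.
by have := A0 (B *m v); rewrite adjmxM !mulmxA.
Qed.

Lemma psdmx_diag n (a : 'rV[C]_n) : (forall i, 0 <= a 0 i) -> psdmx (diag_mx a).
Proof.
move=> a0.
suff -> : diag_mx a = adjmx (diag_mx (map_mx sqrtC a)) *m diag_mx (map_mx sqrtC a).
  exact: psdmx_gram.
rewrite /adjmx map_diag_mx tr_diag_mx mulmx_diag; congr diag_mx.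
apply/rowP => i; rewrite !mxE /= conj_Creal ?sqrtC_real //.
by rewrite -expr2 sqrtCK.
Qed.

Lemma psdmx_diag_ge0 n (A : 'M[C]_n) i : psdmx A -> 0 <= A i i.
Proof.
case=> _ /(_ (delta_mx i 0)).
have -> : adjmx (delta_mx i 0 : 'cV[C]_n) = delta_mx 0 i.
  by apply/matrixP => j k; rewrite !mxE andbC; case: (_ && _); rewrite ?rmorph1 ?rmorph0.
by rewrite -rowE -colE !mxE.
Qed.

Lemma mxtrace_psd n (A : 'M[C]_n) : psdmx A -> 0 <= \tr A.
Proof. by move=> A0; apply: sumr_ge0 => i _; apply: psdmx_diag_ge0. Qed.

(* [M - M^2 = M (1 - M) M + (1 - M) M (1 - M)] *)
Lemma psdmx_effect_sqr n (M : 'M[C]_n) :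
  psdmx M -> psdmx (1%:M - M) -> psdmx (M - M *m M).
Proof.
move=> M0 M1; have Mh := M0.1; have NMh := M1.1.
have -> : M - M *m M = adjmx M *m (1%:M - M) *m M +
    adjmx (1%:M - M) *m M *m (1%:M - M).
  rewrite -Mh -NMh !(mulmxBl, mulmxBr, mul1mx, mulmx1).
  rewrite ?mulmxA; set M2 := M *m M; set M3 := M2 *m M.
  by rewrite opprB !addrA; apply/matrixP => i j; rewrite !mxE; ring.
by apply: psdmxD; apply: psdmx_conj.
Qed.

End Adjoint.

Section ChiSquare.
Variable C : numClosedFieldType.

(** Here [D] inverts [B], so [adjmx D *m D] is the inverse of [sigma]. Le Cam's argument is
    Cauchy-Schwarz for the pairing of the test [M] with [X], the deviation of the summed
    alternatives from [K] copies of the null state. The gap in acceptance probabilities bounds this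
    pairing away from zero, and hence the chi-square quantity from below. *)
Lemma certifies_chi2 d (sigma : 'M[C]_d) eps n (M : 'M[C]_(d ^ n))
    (W : finType) (rho : W -> 'M[C]_d) (B D : 'M[C]_d) :
  B *m adjmx B = sigma -> B *m D = 1%:M -> density_matrix sigma ->
  (forall w, density_matrix (rho w)) ->
  (forall w, eps <= trnorm (rho w - sigma)) ->
  certifies sigma eps M ->
  (1 + 1 / 9) * #|W|%:R ^+ 2 <=
    \sum_w \sum_w' \tr (adjmx D *m D *m rho w *m rho w') ^+ n.
Proof.
move=> sE BD sd rd rfar [M0 [M1 [Ms Mr]]].
have Mh := M0.1.
set S := tpow sigma n; set T := \sum_w tpow (rho w) n.
set b := tpow B n; set c := tpow D n; set K : C := #|W|%:R.
have K0 : 0 <= K by rewrite ler0n.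
have SE : b *m adjmx b = S by rewrite adjmx_tpow -tpow_mul sE.
have bc : b *m c = 1%:M by rewrite -tpow_mul BD; apply: ntensmx_1.
have cb : adjmx c *m adjmx b = 1%:M by rewrite -adjmxM bc adjmx1.
have Sh : adjmx S = S by rewrite adjmx_tpow -sd.1.1.
have Th : adjmx T = T.
  by rewrite adjmx_sum; apply: eq_bigr => w _; rewrite adjmx_tpow -(rd w).1.1.
have [X XE] : exists X, X = T - K *: S by exists (T - K *: S).
have Kr : K^* = K by apply/CrealP/ger0_real.
have Xh : adjmx X = X by rewrite XE adjmxB adjmxZ Kr Sh Th.
(* [K / 3] is the gap bound on [- \tr (M *m X)], and it is also the multiplier that maximizes
   [2 t (K / 3) - t^2]. *)
pose t := K / 3.
have tr : t^* = t by apply/CrealP/ger0_real; rewrite divr_ge0 ?ler0n.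
have trS : \tr S = 1 by rewrite mxtrace_tpow sd.2 expr1n.
have trT : \tr T = K.
  rewrite raddf_sum /K -[RHS]sumr_const; apply: eq_bigr => w _ /=.
  by rewrite mxtrace_tpow (rd w).2 expr1n.
have trb P : \tr (P *m S) = \tr (adjmx b *m P *m b).
  by rewrite -[in RHS]mulmxA [RHS]mxtrace_mulC -mulmxA SE.
(* [1 - M^2] is positive semidefinite, as the sum of [1 - M] and [M - M^2]. *)
have SM : \tr (M *m S *m M) <= 1.
  rewrite -trS -subr_ge0 mxtrace_mulC mulmxA.
  have -> : \tr S - \tr (M *m M *m S) =
     \tr (adjmx b *m ((1%:M - M) + (M - M *m M)) *m b).
    rewrite -[RHS]trb addrA subrK mulmxBl mul1mx.
    by rewrite raddfB.
  apply/mxtrace_psd/psdmx_conj/psdmxD => //; exact: psdmx_effect_sqr.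
have MX : \tr (M *m X) <= - t.
  rewrite XE mulmxBr raddfB /= -scalemxAr mxtraceZ.
  have MT : \tr (M *m T) <= t.
    rewrite mulmx_sumr raddf_sum /=.
    apply: le_trans (_ : \sum_(w : W) 1 / 3 <= _); last first.
      by rewrite sumr_const -[leLHS]mulr_natr mul1r mulrC.
    apply: ler_sum => w _; have := Mr _ (rd w) (rfar w).
    rewrite -subr_ge0 -[_ <= 1 / 3]subr_ge0; congr (0 <= _).
    by field.
  have : K * (2 / 3) <= K * \tr (M *m S) by rewrite ler_wpM2l.
  move=> H; apply: le_trans (lerB MT H) _.
  by rewrite le_eqVlt /t; apply/orP; left; apply/eqP; field.
(* Cauchy-Schwarz as the nonnegativity of a squared Hilbert-Schmidt norm: it expands to [t^2 \tr (M
   S M) + 2 t \tr (M X) + \tr (S^-1 X X)]. *)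
have : 0 <= \tr ((t *: (M *m b) + X *m adjmx c) *m
                 adjmx (t *: (M *m b) + X *m adjmx c)).
  by rewrite mxtrace_mul_adj !sumr_ge0 // => i _; rewrite sumr_ge0 // => j _; rewrite exprn_ge0.
rewrite adjmxD adjmxZ !adjmxM adjmxK Xh tr -Mh.
rewrite mulmxDl !mulmxDr -!scalemxAr -!scalemxAl !raddfD /= !mxtraceZ.
have -> : \tr (M *m b *m (adjmx b *m M)) = \tr (M *m S *m M).
  by rewrite -SE !mulmxA.
have -> : \tr (M *m b *m (c *m X)) = \tr (M *m X).
  by rewrite mulmxA -(mulmxA M) bc mulmx1.
have -> : \tr (X *m adjmx c *m (adjmx b *m M)) = \tr (M *m X).
  by rewrite mulmxA -(mulmxA X) cb mulmx1 mxtrace_mulC.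
have ccS : adjmx c *m c *m S = 1%:M.
  by rewrite -SE mulmxA -(mulmxA (adjmx c)) (mulmx1C bc) mulmx1.
have Scc : S *m (adjmx c *m c) = 1%:M by apply: mulmx1C.
have -> : \tr (X *m adjmx c *m (c *m X)) =
    (\sum_w \sum_w' \tr (adjmx D *m D *m rho w *m rho w') ^+ n) - K ^+ 2.
  set G := adjmx c *m c in ccS Scc.
  have -> : \tr (X *m adjmx c *m (c *m X)) = \tr (G *m X *m X).
    by rewrite -mulmxA mxtrace_mulC !mulmxA.
  rewrite XE (mulmxBr G) -scalemxAr ccS mulmxBr !mulmxBl -!scalemxAr -!scalemxAl !mul1mx.
  rewrite !raddfB /= !mxtraceZ trT trS.
  have -> : \tr (G *m T *m S) = K by rewrite mxtrace_mulC mulmxA Scc mul1mx.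
  have -> : \tr (G *m T *m T) =
      \sum_w \sum_w' \tr (adjmx D *m D *m rho w *m rho w') ^+ n.
    rewrite -mulmxA {1}/T mulmx_suml mulmx_sumr raddf_sum; apply: eq_bigr => w _ /=.
    rewrite /T !mulmx_sumr raddf_sum; apply: eq_bigr => w' _ /=.
    by rewrite /G adjmx_tpow -!tpow_mul mxtrace_tpow !mulmxA.
  by ring.
set Q := (\sum_w _) => H.
rewrite -subr_ge0.
have -> : Q - (1 + 1 / 9) * K ^+ 2 = t * (t * \tr (M *m S *m M) + \tr (M *m X)) +
   (t * \tr (M *m X) + (Q - K ^+ 2)) + (t * t * (1 - \tr (M *m S *m M)) +
   2 * t * (- t - \tr (M *m X))).
  by rewrite /t; field.
apply: addr_ge0; first by rewrite mulrDr.
have t0 : 0 <= t by rewrite divr_ge0 ?ler0n.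
by rewrite addr_ge0 ?mulr_ge0 ?subr_ge0 ?invr_ge0 ?ler0n.
Qed.

End ChiSquare.

(** * Spectral facts and Hadamard matrices *)

Section Spectral.
Variable C : numClosedFieldType.

Lemma char_poly_similar n (U V A : 'M[C]_n) :
  U *m V = 1%:M -> char_poly (U *m A *m V) = char_poly A.
Proof.
move=> UV; pose P : 'M[C]_n -> 'M[{poly C}]_n := map_mx (@polyC C).
have UVP : P U *m P V = 1%:M by rewrite -map_mxM UV map_mx1.
rewrite /char_poly /char_poly_mx !map_mxM /=.
have -> : 'X%:M - P U *m P A *m P V = P U *m ('X%:M - P A) *m P V.
  by rewrite mulmxBr mulmxBl scalar_mxC -(mulmxA 'X%:M) UVP mulmx1.
by rewrite !det_mulmx mulrAC -det_mulmx UVP det1 mul1r.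
Qed.

(** Both lists are the roots of one monic polynomial; only their order is undetermined. *)
Lemma eigvals_similar_diag n (U V : 'M[C]_n) (a : 'rV[C]_n) :
  U *m V = 1%:M -> perm_eq (eigvals (U *m diag_mx a *m V)) [seq a 0 i | i : 'I_n].
Proof.
move=> UV; rewrite /eigvals; case: closed_field_poly_normal => r /=.
rewrite (monicP (char_poly_monic _)) scale1r char_poly_similar //.
rewrite char_poly_trig ?diag_mx_is_trig // => E.
apply: prod_XsubC_eq; rewrite -E big_map big_enum /=.
by apply: eq_bigr => i _; rewrite mxE eqxx mulr1n.
Qed.

Lemma trnorm_diag n (U V A : 'M[C]_n) (a : 'rV[C]_n) :
  U *m V = 1%:M -> adjmx A *m A = U *m diag_mx a *m V ->
  trnorm A = \sum_i sqrtC (a 0 i).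
Proof.
move=> UV AE; rewrite /trnorm AE (perm_big _ (eigvals_similar_diag a UV)) /=.
by rewrite big_map big_enum.
Qed.

Lemma hermitian_spectral n (A : 'M[C]_n) : A = adjmx A ->
  exists (V : 'M[C]_n) (s : 'rV[C]_n),
    V *m adjmx V = 1%:M /\ A = adjmx V *m diag_mx s *m V.
Proof.
move=> Ah; have : A \is hermsymmx.
  by apply/is_hermitianmxP; rewrite expr0 scale1r {1}Ah /adjmx map_trmx.
move=> /hermitian_normalmx /orthomx_spectralP AE.
have Vu := spectral_unitarymx A.
have VE : invmx (spectralmx A) = adjmx (spectralmx A).
  by rewrite invmx_unitary // /adjmx map_trmx.
exists (spectralmx A), (spectral_diag A); split; last by rewrite -VE.
by rewrite -VE mulmxV // spectral_unit.
Qed.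

(** Eigenvectors are row vectors here, and row [i] of [V] is one for [s 0 i]. *)
Lemma eigenvalue_unitary_diag n (V : 'M[C]_n) (s : 'rV[C]_n) i :
  V *m adjmx V = 1%:M -> eigenvalue (adjmx V *m diag_mx s *m V) (s 0 i).
Proof.
move=> VV; apply/eigenvalueP; exists (row i V).
  rewrite -row_mul !mulmxA VV mul1mx mul_diag_mx.
  by apply/rowP => j; rewrite !mxE.
apply/eqP => Vi0; have : row i (V *m adjmx V) = 0 by rewrite row_mul Vi0 mul0mx.
rewrite VV => /rowP /(_ i); rewrite !mxE eqxx => /eqP.
by rewrite oner_eq0.
Qed.

End Spectral.

Section Hadamard.
Variable C : numClosedFieldType.

(** Sylvester's doubling construction. *)
Lemma hadamard_pow2 r : exists H : 'M[C]_(2 ^ r),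
  (forall i j, H i j = 1 \/ H i j = -1) /\ H *m H^T = (2 ^ r)%:R%:M.
Proof.
elim: r => [|r [H [H1 HH]]].
  exists (const_mx 1); split=> [i j|]; first by left; rewrite mxE.
  apply/matrixP => i j; rewrite !mxE !ord1 eqxx big_ord1 !mxE mulr1.
  by [].
have -> : (2 ^ r.+1 = 2 ^ r + 2 ^ r)%N by rewrite expnS mul2n addnn.
exists (block_mx H H H (- H)); split.
  move=> i j; rewrite -(splitK i) -(splitK j).
  case: (split i) (split j) => i' [j'|j'] /=;
    rewrite ?(block_mxEul, block_mxEur, block_mxEdl, block_mxEdr) //.
  by rewrite mxE; case: (H1 i' j') => ->; [right|left]; rewrite ?opprK.
rewrite tr_block_mx mulmx_block linearN /= !mulmxN !mulNmx opprK subrr HH.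
by rewrite -raddfD /= -natrD -scalar_mx_block.
Qed.

Lemma hadamard_orthogonal r : let m := (2 ^ r)%N in
  exists h : 'M[C]_m, [/\ forall i j, h i j \is Num.real,
    forall i j, h i j ^+ 2 = m%:R^-1 & h *m h^T = 1%:M].
Proof.
move=> m; have [H [H1 HH]] := hadamard_pow2 r.
have m0 : 0 < m%:R :> C by rewrite ltr0n expn_gt0.
have q0 : 0 < sqrtC m%:R :> C by rewrite sqrtC_gt0.
pose h := (sqrtC m%:R)^-1 *: H.
have hh : h *m h^T = 1%:M.
  rewrite /h linearZ /= -scalemxAr -scalemxAl HH scalerA.
  rewrite -invfM -expr2 sqrtCK scale_scalar_mx mulVf //.
  by rewrite gt_eqF.
exists h; split=> // i j.
  rewrite mxE realM ?realV ?(gtr0_real q0) //.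
  by case: (H1 i j) => ->; rewrite ?realN real1.
rewrite mxE exprMn exprVn sqrtCK.
by case: (H1 i j) => ->; rewrite ?sqrrN expr1n mulr1.
Qed.

End Hadamard.

(** * The perturbed states *)

Section Perturbation.
Variables (C : numClosedFieldType) (m e : nat) (h : 'M[C]_m).
Hypotheses (h_real : forall i j, h i j \is Num.real)
  (h_flat : forall i j, h i j ^+ 2 = m%:R^-1)
  (hhT : h *m h^T = 1%:M).
Implicit Types x y : {ffun 'I_m -> bool}.
Local Notation d := (m + m + e)%N.

Definition signed x y : 'M[C]_m := \matrix_(i, j) (rsign C x i * h i j * rsign C y j).

(** The last [e] coordinates are left alone; they fill up a dimension that need not be twice a power
    of two. *)
Definition pert x y : 'M[C]_d :=
  block_mx (block_mx 0 (signed x y) (signed x y)^T 0) 0 0 0.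

Definition rdiag x : 'M[C]_m := diag_mx (\row_i rsign C x i).

Lemma signedE x y : signed x y = rdiag x *m h *m rdiag y.
Proof. by apply/matrixP => i j; rewrite mul_mx_diag mul_diag_mx !mxE. Qed.

Lemma rsign_mul x x' i :
  rsign C x i * rsign C x' i = rsign C [ffun i => x i (+) x' i] i.
Proof. by rewrite /rsign ffunE signr_addb. Qed.

Lemma rdiag_sqr x : rdiag x *m rdiag x = 1%:M.
Proof.
rewrite mulmx_diag -diag_const_mx; congr diag_mx; apply/rowP => i.
by rewrite !mxE rsign_mul /rsign ffunE addbb.
Qed.

Lemma signed_orthogonal x y :
  signed x y *m (signed x y)^T = 1%:M /\ (signed x y)^T *m signed x y = 1%:M.
Proof.
have H : signed x y *m (signed x y)^T = 1%:M.
  rewrite signedE !trmx_mul !tr_diag_mx !mulmxA -(mulmxA (rdiag x *m h)) rdiag_sqr.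
  by rewrite mulmx1 -(mulmxA (rdiag x)) hhT mulmx1 rdiag_sqr.
by split=> //; apply: mulmx1C.
Qed.

Lemma pert_adj x y : adjmx (pert x y) = pert x y.
Proof.
have sr : map_mx Num.conj (signed x y) = signed x y.
  apply/matrixP => i j; rewrite !mxE /=; apply: conj_Creal.
  by rewrite !realM // rsign_real.
rewrite /adjmx /pert !map_block_mx !map_mx0 -map_trmx sr !tr_block_mx.
by rewrite !trmx0 trmxK.
Qed.

Lemma pert_sqr x y :
  pert x y *m pert x y = diag_mx (row_mx (const_mx 1) 0).
Proof.
have [sst sts] := signed_orthogonal x y.
rewrite /pert !mulmx_block !mulmx0 !mul0mx !addr0 !add0r sst sts.
by rewrite diag_mx_row diag_const_mx -scalar_mx_block raddf0.
Qed.

Lemma mxtrace_pert x y : \tr (pert x y) = 0.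
Proof. by rewrite /pert !mxtrace_block !mxtrace0 !addr0. Qed.

(** The square of [pert x y] is the projection [E] onto the first [2m] coordinates, so
    [1 + P = ((1 + P)^2 + (1 - E)) / 2] for [P] the perturbation. *)
Lemma psd_pert x y : psdmx (1%:M + pert x y).
Proof.
have -> : 1%:M + pert x y = 2^-1 *: (adjmx (1%:M + pert x y) *m (1%:M + pert x y)
    + diag_mx (row_mx (const_mx 0) (const_mx 1))).
  rewrite adjmxD adjmx1 pert_adj mulmxDl !mulmxDr !mul1mx !mulmx1 pert_sqr.
  have -> : diag_mx (row_mx (const_mx 0) (const_mx 1)) =
     1%:M - diag_mx (row_mx (const_mx 1) 0) :> 'M[C]_d.
    rewrite -diag_const_mx -raddfB /=; congr diag_mx.
    by apply/rowP => i; rewrite !mxE; case: split => j; rewrite !mxE ?subrr ?subr0.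
  move: (pert x y) (diag_mx _) => P Q.
  by apply/matrixP => i j; rewrite !mxE; field.
apply: psdmxZ; first by rewrite invr_ge0 ler0n.
apply: psdmxD; first exact: psdmx_gram.
by apply: psdmx_diag => i; rewrite mxE; case: split => j; rewrite mxE // ler01.
Qed.

Lemma mxtrace_diag_mul n (a : 'rV[C]_n) (A : 'M[C]_n) :
  \tr (diag_mx a *m A) = \sum_i a 0 i * A i i.
Proof. by apply: eq_bigr => i _; rewrite mul_diag_mx mxE. Qed.

(** Only entrywise products of the two signed matrices enter the trace. By flatness of [h] each
    equals [1 / m] times signs of the exclusive ors, so the two perturbations matter only through
    their relative signs. *)
Lemma mxtrace_pert_mul (a b : 'rV[C]_m) (c : 'rV[C]_e) x y x' y' :
  \tr (diag_mx (row_mx (row_mx a b) c) *m pert x y *m pert x' y') =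
  m%:R^-1 * chaos (a 0) (b 0) [ffun i => x i (+) x' i] [ffun j => y j (+) y' j].
Proof.
have sE i j : signed x y i j * signed x' y' i j = m%:R^-1 *
    (rsign C [ffun i => x i (+) x' i] i * rsign C [ffun j => y j (+) y' j] j).
  by rewrite -(h_flat i j) -!rsign_mul !mxE; ring.
rewrite -mulmxA /pert !mulmx_block !mulmx0 !mul0mx !addr0 !add0r.
rewrite !diag_mx_row !mulmx_block !mulmx0 !mul0mx !addr0 !add0r.
rewrite !mxtrace_block mxtrace0 addr0 !mxtrace_diag_mul /chaos mulrDr.
congr (_ + _).
  rewrite mulr_suml mulr_sumr; apply: eq_bigr => i _.
  rewrite mxE !mulr_sumr; apply: eq_bigr => j _.
  by rewrite [(signed x' y')^T j i]mxE sE; ring.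
rewrite [(\sum_i _) * _]mulrC mulr_suml mulr_sumr; apply: eq_bigr => j _.
rewrite mxE !mulr_sumr; apply: eq_bigr => i _.
by rewrite [(signed x y)^T j i]mxE sE; ring.
Qed.

End Perturbation.

Section UnitaryConjugation.
Variables (C : numClosedFieldType) (n : nat) (V : 'M[C]_n).
Hypothesis VV : V *m adjmx V = 1%:M.

Lemma mxtrace_unitary_conj (A : 'M[C]_n) : \tr (adjmx V *m A *m V) = \tr A.
Proof. by rewrite mxtrace_mulC mulmxA VV mul1mx. Qed.

Lemma unitary_conjM (A B : 'M[C]_n) :
  adjmx V *m A *m V *m (adjmx V *m B *m V) = adjmx V *m (A *m B) *m V.
Proof. by rewrite !mulmxA -(mulmxA (_ *m A)) VV mulmx1. Qed.

End UnitaryConjugation.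

(** * The lower bound in dimension [m + m + e] *)

Section LowerBound.
Variables (C : numClosedFieldType) (m e : nat) (h : 'M[C]_m).
Hypotheses (h_real : forall i j, h i j \is Num.real)
  (h_flat : forall i j, h i j ^+ 2 = m%:R^-1) (hhT : h *m h^T = 1%:M)
  (m_gt0 : (0 < m)%N).
Local Notation d := (m + m + e)%N.
Local Notation cube := {ffun 'I_m -> bool}.
Variables (V : 'M[C]_d) (s : 'rV[C]_d) (eta : C).
Hypotheses (VV : V *m adjmx V = 1%:M) (eta_gt0 : 0 < eta)
  (eta_le : forall i, eta <= s 0 i).
Let sigma := adjmx V *m diag_mx s *m V.
Let inv_s : 'rV[C]_d := \row_i (s 0 i)^-1.

Definition shifted (w : cube * cube) : 'M[C]_d :=
  adjmx V *m (diag_mx s + eta *: pert e h w.1 w.2) *m V.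

Let s_gt0 i : 0 < s 0 i. Proof. exact: lt_le_trans (eta_le i). Qed.
Let V'V : adjmx V *m V = 1%:M. Proof. exact: mulmx1C. Qed.
Let eta_real : eta^* = eta. Proof. exact/CrealP/gtr0_real. Qed.
Let mC_gt0 : 0 < m%:R :> C. Proof. by rewrite ltr0n. Qed.

(** Since [eta] is below every eigenvalue, the state splits into the nonnegative diagonal [s - eta]
    and [eta] times [1 + pert]. *)
Lemma shifted_density w : \tr sigma = 1 -> density_matrix (shifted w).
Proof.
rewrite mxtrace_unitary_conj // => trs; split; last first.
  by rewrite mxtrace_unitary_conj // raddfD /= mxtraceZ mxtrace_pert mulr0 addr0.
apply: psdmx_conj.
have -> : diag_mx s + eta *: pert e h w.1 w.2 =
    diag_mx (s - const_mx eta) + eta *: (1%:M + pert e h w.1 w.2).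
  by rewrite raddfB /= diag_const_mx scalerDr scale_scalar_mx mulr1 addrA subrK.
apply: psdmxD.
  by apply: psdmx_diag => i; rewrite !mxE subr_ge0.
by apply: psdmxZ (ltW eta_gt0) _; apply: psd_pert.
Qed.

(** The difference squares to [eta^2] times a projection of rank [2m], so it has [2m] singular
    values equal to [eta]. *)
Lemma shifted_trnorm w : trnorm (shifted w - sigma) = (m + m)%:R * eta.
Proof.
have -> : shifted w - sigma = eta *: (adjmx V *m pert e h w.1 w.2 *m V).
  rewrite /shifted mulmxDr mulmxDl addrC addKr.
  by rewrite -scalemxAr -scalemxAl.
rewrite (@trnorm_diag _ _ (adjmx V) V _ (eta ^+ 2 *: row_mx (const_mx 1) 0)) //.
  rewrite big_split_ord /= [X in _ + X]big1 ?addr0; last first.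
    by move=> i _; rewrite mxE row_mxEr mxE mulr0 sqrtC0.
  under eq_bigr do rewrite mxE row_mxEl mxE mulr1 sqrCK ?ltW //.
  by rewrite sumr_const card_ord mulr_natl.
rewrite adjmxZ !adjmxM adjmxK pert_adj // eta_real -scalemxAl -scalemxAr scalerA.
by rewrite mulmxA unitary_conjM // pert_sqr // linearZ /= -scalemxAr -scalemxAl.
Qed.

(** The terms linear in [eta] reduce to traces of perturbations and vanish; the quadratic term is
    given by [mxtrace_pert_mul]. *)
Lemma shifted_chi2 w w' : \tr sigma = 1 ->
  \tr (adjmx V *m diag_mx inv_s *m V *m shifted w *m shifted w') =
  1 + eta ^+ 2 / m%:R *
    chaos (fun i => inv_s 0 (lshift e (lshift m i)))
      (fun j => inv_s 0 (lshift e (rshift m j)))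
      [ffun i => w.1 i (+) w'.1 i] [ffun j => w.2 j (+) w'.2 j].
Proof.
rewrite mxtrace_unitary_conj // => trs.
rewrite /shifted !unitary_conjM // mxtrace_unitary_conj //.
set P := pert _ _ _ _; set P' := pert _ _ _ _.
have is1 : diag_mx inv_s *m diag_mx s = 1%:M.
  rewrite mulmx_diag -diag_const_mx; congr diag_mx; apply/rowP => i.
  by rewrite !mxE mulVf // gt_eqF.
have si1 : diag_mx s *m diag_mx inv_s = 1%:M by apply: mulmx1C.
rewrite (mulmxDr (diag_mx inv_s)) is1 -scalemxAr mulmxDl !mulmxDr !mul1mx -!scalemxAr -!scalemxAl.
rewrite !raddfD /= !mxtraceZ trs mxtrace_pert mulr0 addr0.
have -> : \tr (diag_mx inv_s *m P *m diag_mx s) = 0.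
  by rewrite mxtrace_mulC mulmxA si1 mul1mx mxtrace_pert.
rewrite mulr0 add0r mulrA -expr2 -mulrA; congr (_ + _ * _).
have {1}-> : inv_s = row_mx (row_mx (\row_i inv_s 0 (lshift e (lshift m i)))
    (\row_j inv_s 0 (lshift e (rshift m j)))) (\row_j inv_s 0 (rshift (m + m) j)).
  apply/rowP => i; rewrite -(splitK i); case: (split i) => k /=.
    rewrite row_mxEl -(splitK k); case: (split k) => l /=.
      by rewrite row_mxEl mxE [RHS]mxE mxE.
    by rewrite row_mxEr mxE [RHS]mxE mxE.
  by rewrite row_mxEr mxE [RHS]mxE mxE.
rewrite mxtrace_pert_mul //; congr (_ * _).
rewrite /chaos; congr (_ * _ + _ * _); apply: eq_bigr => i _; by rewrite mxE.
Qed.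

Lemma certifies_lower_bound n (M : 'M[C]_(d ^ n)) :
  density_matrix sigma -> certifies sigma ((m + m)%:R * eta) M ->
  1 / 20 <= 4 * (\sum_i inv_s 0 i ^+ 2) * n%:R ^+ 2 * eta ^+ 4 / m%:R.
Proof.
move=> sd cert; set N := \sum_i _.
have inv_real i : inv_s 0 i \is Num.real.
  by rewrite mxE realV gtr0_real.
have N0 : 0 <= N by apply: sumr_ge0 => i _; rewrite -realEsqr.
have eta0 := ltW eta_gt0.
set q := (X in _ <= X).
have q0 : 0 <= q.
  by rewrite /q !mulr_ge0 ?exprn_ge0 ?invr_ge0 ?ler0n.
(* If the bound fails then [q < 1 / 20], and the two chi-square estimates will contradict each
   other. *)
have [//|q20] := real_leP (ger0_real (divr_ge0 ler01 (ler0n C 20))) (ger0_real q0).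
pose rt : 'rV[C]_d := map_mx sqrtC s.
have rt_gt0 i : 0 < rt 0 i by rewrite mxE sqrtC_gt0.
pose irt : 'rV[C]_d := \row_i (rt 0 i)^-1.
pose B := adjmx V *m diag_mx rt; pose D := diag_mx irt *m V.
have adj_diag (a : 'rV[C]_d) : (forall i, a 0 i \is Num.real) ->
    adjmx (diag_mx a) = diag_mx a.
  move=> ar; rewrite /adjmx map_diag_mx tr_diag_mx; congr diag_mx.
  by apply/rowP => i; rewrite mxE; apply: conj_Creal.
have irt_real i : irt 0 i \is Num.real by rewrite mxE realV gtr0_real.
have sE : B *m adjmx B = sigma.
  rewrite adjmxM adjmxK adj_diag => [|i]; last by rewrite gtr0_real.
  rewrite !mulmxA -(mulmxA _ (diag_mx rt) (diag_mx rt)) mulmx_diag; congr (_ *m diag_mx _ *m _).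
  by apply/rowP => i; rewrite !mxE -expr2 sqrtCK.
have BD : B *m D = 1%:M.
  rewrite /B /D !mulmxA -(mulmxA _ (diag_mx rt) (diag_mx irt)) mulmx_diag.
  have -> : \row_j (rt 0 j * irt 0 j) = const_mx 1.
    by apply/rowP => i; rewrite !mxE divff // gt_eqF ?sqrtC_gt0.
  by rewrite diag_const_mx mulmx1.
have DD : adjmx D *m D = adjmx V *m diag_mx inv_s *m V.
  rewrite adjmxM adj_diag // /D !mulmxA -(mulmxA _ (diag_mx irt) (diag_mx irt)) mulmx_diag.
  congr (_ *m diag_mx _ *m _).
  by apply/rowP => i; rewrite !mxE -invfM -expr2 sqrtCK.
have trs := sd.2.
have far w : (m + m)%:R * eta <= trnorm (shifted w - sigma) by rewrite shifted_trnorm.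
have := certifies_chi2 sE BD sd (fun w => shifted_density w trs) far cert.
rewrite DD.
under eq_bigr do under eq_bigr do rewrite shifted_chi2 //.
set a := (fun i => inv_s 0 (lshift e (lshift m i))).
set b := (fun j => inv_s 0 (lshift e (rshift m j))).
pose F (z w : cube) := (1 + eta ^+ 2 / m%:R * chaos a b z w) ^+ n.
pose addc (x z : cube) : cube := [ffun i => x i (+) z i].
have addcK x : involutive (addc x).
  by move=> z; apply/ffunP => i; rewrite !ffunE addKb.
(* For fixed [w], relative signs run bijectively over the cube as [w'] varies, so the double sum
   over pairs is a multiple of one sum over [z] and [y]. *)
have EF (w : cube * cube) :
    \sum_(w' : cube * cube) F (addc w.1 w'.1) (addc w.2 w'.2) = \sum_z \sum_y F z y.
  rewrite -(pair_big xpredT xpredT (fun z y => F (addc w.1 z) (addc w.2 y))) /=.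
  rewrite [RHS](reindex_inj (inv_inj (addcK w.1))) /=; apply: eq_bigr => z _.
  by rewrite [RHS](reindex_inj (inv_inj (addcK w.2))).
rewrite (eq_bigr _ (fun w _ => EF w)) sumr_const -[X in _ <= X]mulr_natr card_prod.
rewrite natrM expr2 mulrA.
set K := #|_|%:R.
have K0 : 0 < K by rewrite ltr0n card_ffun expn_gt0 card_bool.
rewrite ler_pM2r ?mulr_gt0 //.
have NE : N = \sum_i a i ^+ 2 + \sum_j b j ^+ 2 +
    \sum_k inv_s 0 (rshift (m + m) k) ^+ 2.
  by rewrite /N !big_split_ord.
have sum_sqr_ge0 (T : finType) (f : T -> 'I_d) : 0 <= \sum_i inv_s 0 (f i) ^+ 2.
  by apply: sumr_ge0 => i _; rewrite -realEsqr.
have aN : \sum_i a i ^+ 2 <= N by rewrite NE -addrA lerDl addr_ge0 ?sum_sqr_ge0.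
have bN : \sum_i b i ^+ 2 <= N.
  by rewrite NE -addrA addrCA lerDl addr_ge0 ?sum_sqr_ge0.
suff lt : \sum_z \sum_y F z y < (1 + 1 / 9) * (K * K) by rewrite (lt_geF lt).
(* With variance bound [N m] and [mu = eta^2 / m], the parameter [4 V n^2 mu^2] is exactly [q]. *)
apply: (@chaos_chi2 _ _ _ a b _ _ (N * m%:R) _ _ n _ q) => //.
- by move=> i; apply: inv_real.
- by move=> i; apply: inv_real.
- by rewrite card_ord ler_wpM2r ?ler0n.
- by rewrite card_ord mulrC ler_wpM2r ?ler0n.
- by rewrite divr_ge0 ?exprn_ge0 ?ler0n.
- by rewrite /q; field; rewrite gt_eqF.
- exact: ltW.
Qed.

End LowerBound.

(** * General dimension and explicit constants *)

Section Certification.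
Variable C : numClosedFieldType.

Lemma positive_spectral d (sigma : 'M[C]_d) :
  sigma = adjmx sigma -> (forall l, eigenvalue sigma l -> 0 < l) ->
  exists (V : 'M[C]_d) (s : 'rV[C]_d),
  [/\ V *m adjmx V = 1%:M, sigma = adjmx V *m diag_mx s *m V,
      forall i, eigenvalue sigma (s 0 i) &
      hsnorm (invmx sigma) = sqrtC (\sum_i (s 0 i)^-1 ^+ 2)].
Proof.
move=> sh pos; have [V [s [VV sE]]] := hermitian_spectral sh.
have ev i : eigenvalue sigma (s 0 i) by rewrite sE eigenvalue_unitary_diag.
exists V, s; split=> //; rewrite /hsnorm -mxtrace_mul_adj.
pose t : 'rV[C]_d := \row_i (s 0 i)^-1.
have s0 i : 0 < s 0 i := pos _ (ev i).
have invE : invmx sigma = adjmx V *m diag_mx t *m V.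
  have H : sigma *m (adjmx V *m diag_mx t *m V) = 1%:M.
    rewrite sE unitary_conjM // mulmx_diag.
    have -> : \row_j (s 0 j * t 0 j) = const_mx 1.
      by apply/rowP => i; rewrite !mxE divff // gt_eqF.
    by rewrite diag_const_mx mulmx1 (mulmx1C VV).
  by rewrite -[LHS]mulmx1 -H mulKmx //; case: (mulmx1_unit H).
rewrite invE !adjmxM adjmxK (mulmxA (adjmx V) _ V) unitary_conjM // mxtrace_unitary_conj //.
congr sqrtC; rewrite mxtrace_diag_mul; apply: eq_bigr => i _.
rewrite !mxE eqxx mulr1n /= conj_Creal ?expr2 //.
by rewrite realV gtr0_real.
Qed.

Lemma pow2_half d : (2 <= d)%N ->
  exists r, ((2 ^ r + 2 ^ r <= d) && (d <= 4 * 2 ^ r))%N.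
Proof.
(* The largest power of two not exceeding [d] is [2 * 2^r], and [d] lies below its double. *)
move=> d2; exists (trunc_log 2 d).-1.
have d0 : (0 < d)%N by apply: leq_trans d2.
have t0 : (0 < trunc_log 2 d)%N by rewrite trunc_log_gt0 //.
have le := trunc_logP (isT : (1 < 2)%N) d0.
have lt := trunc_log_ltn d (isT : (1 < 2)%N).
move: le lt; rewrite -{1 2}(prednK t0) !expnS; lia.
Qed.

Lemma certification_lower_bound d (eps : C) (sigma : 'M[C]_d) n (M : 'M[C]_(d ^ n)) :
  (2 <= d)%N -> 0 < eps -> density_matrix sigma ->
  (forall l, eigenvalue sigma l -> 2 * eps / d%:R <= l) ->
  certifies sigma eps M ->
  128^-1 * (d%:R ^+ 2 * sqrtC d%:R) / (hsnorm (invmx sigma) * eps ^+ 2) <= n%:R.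
Proof.
move=> d2 eps0 sd ev_ge cert.
have d0 : 0 < d%:R :> C by rewrite ltr0n; lia.
have ev_gt0 l : eigenvalue sigma l -> 0 < l.
  by move=> /ev_ge; apply: lt_le_trans; rewrite divr_gt0 // mulr_gt0 // ltr0n.
have [V [s [VV sE sev ->]]] := positive_spectral sd.1.1 ev_gt0.
have [r /andP[md d4m]] := pow2_half d2.
have [h [h_real h_flat hhT]] := hadamard_orthogonal C r.
set m := (2 ^ r)%N in md d4m h h_real h_flat hhT.
have m0 : (0 < m)%N by rewrite expn_gt0.
have mC0 : 0 < m%:R :> C by rewrite ltr0n.
pose eta := eps / (m + m)%:R.
have mm0 : 0 < (m + m)%:R :> C by rewrite ltr0n addn_gt0 m0.
have eta0 : 0 < eta by rewrite divr_gt0.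
have etaE : (m + m)%:R * eta = eps by rewrite mulrC divfK // gt_eqF.
have eta_le i : eta <= s 0 i.
  (* [eps / (2m) <= 2 eps / d] amounts to [d <= 4m]. *)
  apply: le_trans (ev_ge _ (sev i)).
  rewrite ler_pdivrMr // mulrAC ler_pdivlMr // [2 * eps]mulrC -mulrA ler_pM2l //.
  by rewrite -natrM ler_nat; lia.
set N := \sum_i _.
have bound : 1 / 20 <= 4 * N * n%:R ^+ 2 * eta ^+ 4 / m%:R.
  (* The types of [sigma], [M], [V] and [s] depend on [d], so all are generalized before [d] is
     rewritten as [m + m + e]. *)
  move: {ev_ge ev_gt0 d0 d2 d4m} sigma M sd cert V s VV sE sev eta_le @N.
  rewrite -(subnKC md) => sigma M sd cert V s VV sE _ eta_le N.
  rewrite sE in sd cert.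
  rewrite -etaE in cert.
  have := certifies_lower_bound h_real h_flat hhT m0 VV eta0 eta_le sd cert.
  by congr (_ <= 4 * _ * _ * _ / _); apply: eq_bigr => i _; rewrite mxE.
have N0 : 0 < N.
  rewrite lt_def; apply/andP; split; last first.
    by apply: sumr_ge0 => i _; rewrite exprn_ge0 // invr_ge0 ltW // ev_gt0.
  apply/eqP => NE; move: bound; rewrite NE !(mulr0, mul0r) lt_geF //.
  by rewrite divr_gt0 // ltr0n.
have m5 : m%:R ^+ 5 <= 5 * (n%:R ^+ 2 * N * eps ^+ 4).
  move: bound; rewrite ler_pdivlMr // mulrAC ler_pdivrMr ?ltr0n // => bound.
  have eta4 : eps ^+ 4 = 16 * m%:R ^+ 4 * eta ^+ 4.
    by rewrite -etaE natrD; ring.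
  have m4 : 0 < m%:R ^+ 4 :> C by rewrite exprn_gt0.
  rewrite eta4 exprS -(mul1r (m%:R * _)).
  have -> : 5 * (n%:R ^+ 2 * N * (16 * m%:R ^+ 4 * eta ^+ 4)) =
     4 * N * n%:R ^+ 2 * eta ^+ 4 * 20 * m%:R ^+ 4 by ring.
  by rewrite mulrA ler_pM2r.
have d5 : d%:R ^+ 5 <= 1024 * m%:R ^+ 5 :> C.
  have -> : 1024 * m%:R ^+ 5 = (4 * m%:R) ^+ 5 :> C by ring.
  by rewrite lerXn2r ?nnegrE ?mulr_ge0 ?ler0n // -natrM ler_nat.
have sN : 0 < sqrtC N by rewrite sqrtC_gt0.
have sd0 : 0 < sqrtC d%:R :> C by rewrite sqrtC_gt0.
rewrite ler_pdivrMr ?mulr_gt0 ?exprn_gt0 //.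
have sN' := ltW sN; have sd0' := ltW sd0; have eps0' := ltW eps0.
(* Squaring removes the roots. From [d <= 4m] and [m5] comes [d^5 <= 5120 n^2 N eps^4], which fits
   below [128^2 = 16384]. *)
rewrite -(@ler_pXn2r _ 2) ?nnegrE ?mulr_ge0 ?exprn_ge0 ?invr_ge0 ?ler0n //.
have -> : (n%:R * (sqrtC N * eps ^+ 2)) ^+ 2 = n%:R ^+ 2 * N * eps ^+ 4.
  by rewrite -[in RHS](sqrtCK N); ring.
have -> : (128^-1 * (d%:R ^+ 2 * sqrtC d%:R)) ^+ 2 = d%:R ^+ 5 / 16384 :> C.
  have -> : d%:R ^+ 5 = d%:R ^+ 4 * sqrtC d%:R ^+ 2 :> C by rewrite sqrtCK -exprSr.
  by field.
rewrite ler_pdivrMr ?ltr0n //; apply: le_trans d5 _.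
set Y := _ * eps ^+ 4 in m5 *.
apply: le_trans (_ : 1024 * (5 * Y) <= _).
  by rewrite ler_wpM2l ?ler0n.
have Y0 : 0 <= Y by rewrite !mulr_ge0 ?exprn_ge0 ?ler0n // ltW.
by rewrite mulrA mulrC ler_wpM2l // -natrM ler_nat.
Qed.
(** Each of the [d] inverse eigenvalues is at most [d / a]. The resulting bound [d^(3/2) / a] on the
    norm turns [d^(5/2)] over the norm into at least [a d]. *)
Lemma hsnorm_inv_le d (a : C) (sigma : 'M[C]_d) :
  (0 < d)%N -> 0 < a -> sigma = adjmx sigma ->
  (forall l, eigenvalue sigma l -> a / d%:R <= l) ->
  0 < hsnorm (invmx sigma) /\ a * hsnorm (invmx sigma) <= d%:R * sqrtC d%:R.
Proof.
move=> d0 a0 sh ev_ge; have dC0 : 0 < d%:R :> C by rewrite ltr0n.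
have ev_gt0 l : eigenvalue sigma l -> 0 < l.
  by move=> /ev_ge; apply: lt_le_trans; rewrite divr_gt0.
have [V [s [VV sE sev ->]]] := positive_spectral sh ev_gt0.
have is_gt0 i : 0 < (s 0 i)^-1 by rewrite invr_gt0 ev_gt0.
set N := \sum_i _.
have N0 : 0 < N.
  rewrite /N (bigD1 (Ordinal d0)) //= ltr_pwDl ?exprn_gt0 //.
  by apply: sumr_ge0 => i _; rewrite exprn_ge0 // ltW.
have sN : 0 < sqrtC N by rewrite sqrtC_gt0.
have sd0 : 0 < sqrtC d%:R :> C by rewrite sqrtC_gt0.
split=> //.
have sN' := ltW sN; have sd0' := ltW sd0; have a0' := ltW a0.
rewrite -(@ler_pXn2r _ 2) ?nnegrE ?mulr_ge0 ?ler0n //.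
rewrite !exprMn !sqrtCK mulr_sumr.
apply: le_trans (_ : \sum_(i < d) d%:R ^+ 2 <= _); last first.
  by rewrite sumr_const card_ord mulr_natr.
apply: ler_sum => i _; rewrite -exprMn.
have ai0 : 0 <= a * (s 0 i)^-1 by rewrite mulr_ge0 // ltW.
rewrite lerXn2r ?nnegrE ?ler0n // ler_pdivrMr ?ev_gt0 //.
by rewrite mulrC -ler_pdivrMr // ev_ge.
Qed.

End Certification.

Theorem theorem4p6 (R : realType) :
  (exists c : R[i], 0 < c /\
    forall (d : nat) (eps : R[i]) (sigma : 'M[R[i]]_d) (n : nat)
           (M : 'M[R[i]]_(d ^ n)),
      (2 <= d)%N -> 0 < eps -> eps <= 1 / 2 ->
      density_matrix sigma ->
      (forall l, eigenvalue sigma l -> 2 * eps / d%:R <= l) ->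
      certifies sigma eps M ->
      c * (d%:R ^+ 2 * sqrtC d%:R) / (hsnorm (invmx sigma) * eps ^+ 2)
        <= n%:R)
  /\
  (forall a : R[i], 0 < a -> exists c : R[i], 0 < c /\
    forall (d : nat) (eps : R[i]) (sigma : 'M[R[i]]_d) (n : nat)
           (M : 'M[R[i]]_(d ^ n)),
      (2 <= d)%N -> 0 < eps -> eps <= 1 / 2 ->
      density_matrix sigma ->
      (forall l, eigenvalue sigma l -> 2 * eps / d%:R <= l) ->
      (forall l, eigenvalue sigma l -> a / d%:R <= l) ->
      certifies sigma eps M ->
      c * d%:R / eps ^+ 2 <= n%:R).
Proof.
split=> [|a a0].
  exists 128^-1; split; first by rewrite invr_gt0 ltr0n.
  by move=> d eps sigma n M d2 eps0 _; apply: certification_lower_bound.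
exists (128^-1 * a); split; first by rewrite mulr_gt0 ?invr_gt0 ?ltr0n.
move=> d eps sigma n M d2 eps0 _ sd ev_eps ev_a cert.
apply: le_trans (certification_lower_bound d2 eps0 sd ev_eps cert).
have d0 : (0 < d)%N by apply: leq_trans d2.
have [N0 Na] := hsnorm_inv_le d0 a0 sd.1.1 ev_a.
set N := hsnorm _ in N0 Na *.
have e2 : 0 < eps ^+ 2 by rewrite exprn_gt0.
rewrite ler_pdivlMr ?mulr_gt0 //.
have -> : 128^-1 * a * d%:R / eps ^+ 2 * (N * eps ^+ 2) = 128^-1 * (d%:R * (a * N)).
  by field; rewrite gt_eqF.
by rewrite ler_wpM2l ?invr_ge0 ?ler0n // expr2 -mulrA ler_wpM2l ?ler0n.
Qed.
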